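(* Let $j\in\mathbb{N}$. As $n\to\infty$, the $j$-dimensional random vector $(n+1-\sigma^{-1}_{n-j+1},\ n+1-\sigma^{-1}_{n-j+2},\ \dots,\ n+1-\sigma^{-1}_n)$ under $P_n^{\text{park}}$ converges in distribution to the random vector $$\left(\sum_{r=1}^jX_r,\ \sum_{r=2}^jX_r,\ \dots,\ X_{j-1}+X_j,\ X_j\right),$$ where $\{X_r\}_{r=1}^j$ are IID with the Borel distribution. In particular, for any $j\in\mathbb{N}$, the last $j$ cars from among the $n$ cars park in increasing order with probability approaching 1 as $n\to\infty$: $$\lim_{n\to\infty}P_n^{\text{park}}\left(\sigma^{-1}_{n+1-j}<\sigma^{-1}_{n+1-j+1}<\cdots<\sigma^{-1}_n\right)=1.$$
   Context: $[n]=\{1,\dots,n\}$ and $S_n$ is the set of permutations $\sigma=\sigma_1\cdots\sigma_n$ of $[n]$; $\sigma^{-1}_k=j$ if and only if $\sigma_j=k$. Parking: cars $1,\dots,n$ arrive in this order on a one-way street with spaces $1,\dots,n$; given a sequence $\pi=(\pi_1,\dots,\pi_n)\in[n]^n$ of preferred spaces, car $i$ parks in space $\pi_i$ if it is free, and otherwise in the first free space with number greater than $\pi_i$, if one exists (if none exists the car exits the street). $\pi$ is a parking function on $[n]$ if all $n$ cars are able to park; $\mathcal{P}_n$ is the set of parking functions on $[n]$. The map $T_n:\mathcal{P}_n\to S_n$ is $T_n(\pi)=\sigma$, where $\sigma_j$ is the number of the car that parked in space $j$, $j\in[n]$. The probability measure $P_n^{\text{park}}$ on $S_n$ is $P_n^{\text{park}}(\sigma)=|T_n^{-1}(\{\sigma\})|/|\mathcal{P}_n|$.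 The Borel distribution is the probability distribution on $\{1,2,\dots\}$ giving mass $e^{-m}\frac{m^{m-1}}{m!}$ to $m$. *)

(* Defs.v *)
From HB Require Import structures.
From mathcomp Require Import all_boot all_order all_algebra fingroup perm.
From mathcomp Require Import all_classical all_reals all_analysis.

Set Implicit Arguments.
Unset Strict Implicit.
Unset Printing Implicit Defensive.

Import Order.TTheory GRing.Theory Num.Theory.
Import numFieldNormedType.Exports.

Local Open Scope classical_set_scope.
Local Open Scope ring_scope.

(* Cars and spaces are both numbered 1, ..., n in the mathematics; here they
   are the elements of 'I_n, so that i : 'I_n stands for the number i + 1. *)

Section parking.
Variable n : nat.
Implicit Types (occ : {set 'I_n}) (p k : 'I_n) (s : seq 'I_n).

(* enum 'I_n is increasing, so this is the least free space >= p. *)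
Definition first_free occ p : option 'I_n :=
  ohead [seq k : 'I_n <- enum 'I_n | (p <= k)%N && (k \notin occ)].

(* The spaces taken by successive cars with preferences s when the spaces in
   occ are already taken; None records a car that exits the street. *)
Fixpoint spaces occ s : seq (option 'I_n) :=
  if s is p :: s' then
    let o := first_free occ p in
    o :: spaces (if o is Some k then k |: occ else occ) s'
  else [::].

Definition is_parking (pi : n.-tuple 'I_n) : bool :=
  None \notin spaces finset.set0 pi.

Definition parking_function : Type := { pi : n.-tuple 'I_n | is_parking pi }.

HB.instance Definition _ := Finite.on parking_function.

Lemma size_spaces occ s : size (spaces occ s) = size s.
Proof. by elim: s occ => //= p s IHs occ; rewrite IHs. Qed.

Lemma first_free_notin occ p k : first_free occ p = Some k -> k \notin occ.
Proof.
have headP (l : seq 'I_n) : ohead l = Some k -> k \in l.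
  by case: l => //= x l [->]; exact: mem_head.
by move/headP; rewrite mem_filter => /andP[/andP[]].
Qed.

Lemma spaces_notin occ s i k :
  nth None (spaces occ s) i = Some k -> k \notin occ.
Proof.
elim: s occ i => [|p s IHs] occ [|i] //=; first exact: first_free_notin.
move/IHs; case: (first_free occ p) => [l|//].
by rewrite in_setU1 negb_or => /andP[].
Qed.

Lemma spaces_inj occ s i j k :
  nth None (spaces occ s) i = Some k -> nth None (spaces occ s) j = Some k ->
  i = j.
Proof.
elim: s occ i j => [|p s IHs] occ [|i] [|j] //=.
- by move=> -> /spaces_notin; rewrite setU11.
- by move=> /[swap] -> /spaces_notin; rewrite setU11.
- by move=> iE /(IHs _ _ _ iE) ->.
Qed.

(* The space taken by car i; the default value of odflt is never used when pi
   is a parking function, by space_ofE. *)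
Definition space_of (pi : parking_function) (i : 'I_n) : 'I_n :=
  odflt i (nth None (spaces finset.set0 (val pi)) i).

Lemma space_ofE (pi : parking_function) (i : 'I_n) :
  nth None (spaces finset.set0 (val pi)) i = Some (space_of pi i).
Proof.
rewrite /space_of; case: pi => pi /= pip; move: (pip); rewrite /is_parking.
case E : nth => [//|] /negP[]; rewrite -E.
by rewrite mem_nth// size_spaces size_tuple.
Qed.

Lemma space_of_inj (pi : parking_function) : injective (space_of pi).
Proof.
move=> i j ij; apply/val_inj/(@spaces_inj finset.set0 (val pi) _ _ (space_of pi i)).
  exact: space_ofE.
by rewrite ij space_ofE.
Qed.

(* sigma = outcome pi has sigma_j = the car that parked in space j. *)
Definition outcome (pi : parking_function) : 'S_n :=
  ((perm (@space_of_inj pi))^-1)%g.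

Lemma outcomeP (pi : parking_function) (i j : 'I_n) :
  outcome pi j = i <-> nth None (spaces finset.set0 (val pi)) i = Some j.
Proof.
rewrite space_ofE /outcome; split => [<-|[<-]].
  by rewrite -[X in Some X](permE (@space_of_inj pi)) permKV.
by rewrite -(permE (@space_of_inj pi)) permK.
Qed.

(* Everybody prefers the space bearing the number of their car. *)
Lemma card_parking_function_gt0 : (0 < #|{: parking_function}|)%N.
Proof.
suff idP : is_parking (ord_tuple n).
  by apply/card_gt0P; exists (Sub (ord_tuple n) idP : parking_function).
have ffE (occ : {set 'I_n}) p : p \notin occ -> first_free occ p = Some p.
  move=> pocc; rewrite /first_free.
  have : sorted ltn [seq val k | k <- enum 'I_n].
    by rewrite val_enum_ord iota_ltn_sorted.
  have : p \in enum 'I_n by rewrite mem_enum.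
  elim: (enum 'I_n) => //= a l IHl; rewrite inE => /predU1P[pE|pl].
    by rewrite -pE leqnn pocc.
  move=> pal; case: ifPn => [/andP[pa _]|_]; last first.
    by apply: IHl => //; exact: path_sorted pal.
  have := order_path_min ltn_trans pal.
  by move/allP => /(_ _ (map_f _ pl)); rewrite /= ltnNge pa.
rewrite /is_parking/=.
have : {in enum 'I_n, forall p, p \notin (finset.set0 : {set 'I_n})}.
  by move=> p _; rewrite inE.
move: (finset.set0 : {set 'I_n}) (enum_uniq 'I_n).
elim: (enum 'I_n) => //= a l IHl occ /andP[al ul] occl.
rewrite ffE ?occl ?mem_head// inE/=; apply: IHl => // p pl.
rewrite in_setU1 negb_or occl ?inE ?pl ?orbT// andbT.
by apply: contraNneq al => <-.
Qed.

End parking.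

(* sigma^{-1}_k for the 1-based number k: the 1-based position of k in sigma,
   and the junk value 0 when k is not in {1, ..., n}. *)
Definition position n (sigma : 'S_n) (k : nat) : nat :=
  if k is k'.+1 then
    if insub k' is Some i then (val ((sigma^-1)%g i)).+1 else 0%N
  else 0%N.

(* {perm T} unfolds to perm_type T, which carries the canonical structures. *)
HB.instance Definition _ (T : finType) := isPointed.Build (perm_type T) 1%g.

HB.instance Definition _ (T : finType) :=
  @isMeasurable.Build default_measure_display (perm_type T)
    discrete_measurable discrete_measurable0
    discrete_measurableC discrete_measurableU.

Section park_prob.
Variables (R : realType) (n : nat).

Definition park_pmf (sigma : 'S_n) : R :=
  #|[set pi : parking_function n | outcome pi == sigma]%SET|%:R
  / #|{: parking_function n}|%:R.

Definition park_prob (A : set 'S_n) : \bar R :=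
  \esum_(sigma in A) (park_pmf sigma)%:E.

Lemma park_pmf_ge0 sigma : 0 <= park_pmf sigma.
Proof. by rewrite divr_ge0. Qed.

Let park_prob0 : park_prob set0 = 0%E.
Proof. by rewrite /park_prob esum_set0. Qed.

Let park_prob_ge0 A : (0 <= park_prob A)%E.
Proof. by apply: esum_ge0 => s _; rewrite lee_fin park_pmf_ge0. Qed.

Let park_prob_sigma_additive : semi_sigma_additive park_prob.
Proof.
move=> F mF tF mUF; apply: cvg_toP.
  apply: ereal_nondecreasing_is_cvgn => a b ab.
  by apply: lee_sum_nneg_natr => // k _ _; exact: park_prob_ge0.
by rewrite /park_prob nneseries_sum_bigcup// => s; rewrite lee_fin park_pmf_ge0.
Qed.

HB.instance Definition _ := isMeasure.Build _ _ _ park_prob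
  park_prob0 park_prob_ge0 park_prob_sigma_additive.

Let park_prob_setT : park_prob setT = 1%E.
Proof.
rewrite /park_prob esum_fset; [|exact: finite_finset|]; last first.
  by move=> s _; rewrite lee_fin park_pmf_ge0.
rewrite (fsbigE (enum 'S_n)) ?enum_uniq//; last first.
  by move=> s _; rewrite mem_enum.
under eq_bigl do rewrite in_setT.
rewrite big_enum/= sumEFin -mulr_suml -natr_sum.
suff -> : (\sum_(i : 'S_n) #|[set pi : parking_function n | outcome pi == i]%SET|
    = #|{: parking_function n}|)%N.
  by rewrite divff// pnatr_eq0 -lt0n card_parking_function_gt0.
rewrite -[RHS]sum1_card (partition_big (@outcome n) xpredT)//=.
by apply: eq_bigr => s _; rewrite -sum1_card; apply: eq_bigl => p; rewrite inE.
Qed.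

HB.instance Definition _ :=
  @Measure_isProbability.Build _ _ R park_prob park_prob_setT.

End park_prob.
Arguments park_prob : clear implicits.

Definition borel_pmf (R : realType) (m : nat) : R :=
  if m is 0%N then 0 else expR (- m%:R) * m%:R ^+ m.-1 / m`!%:R.

Definition has_borel_distribution (R : realType) d (T : measurableType d)
    (P : probability T R) (X : {RV P >-> nat}) : Prop :=
  forall m, distribution P X [set m] = (borel_pmf R m)%:E.

Definition mutually_independent (R : realType) d (T : measurableType d)
    d' (T' : measurableType d') (P : probability T R) (I : finType)
    (X : I -> {RV P >-> T'}) : Prop :=
  forall (J : {set I}) (A : I -> set T'), (forall i, measurable (A i)) ->
    P (\bigcap_(i in [set` J]) X i @^-1` A i)
    = (\prod_(i in J) P (X i @^-1` A i))%E.

(* Convergence in distribution of random vectors in R^k, each of them on its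
   own probability space: E[f(Y_n)] --> E[f(Y)] for f bounded continuous.
   Measurability of the vectors is left to the user: it is automatic for
   functions on 'S_n and for functions of finitely many nat-valued random
   variables. *)
Definition cvg_in_distribution (R : realType) (k : nat)
    (dn : nat -> measure_display) (Tn : forall n, measurableType (dn n))
    (Pn : forall n, probability (Tn n) R) (Yn : forall n, Tn n -> 'rV[R]_k)
    d (T : measurableType d) (P : probability T R) (Y : T -> 'rV[R]_k) : Prop :=
  forall f : 'rV[R]_k -> R, continuous f -> bounded_fun f ->
    (fun n => 'E_(Pn n)[f \o Yn n])%E @ \oo --> 'E_P[f \o Y]%E.

(* Main.v *)
Require Import Defs.
From HB Require Import structures.
From mathcomp Require Import all_boot all_order all_algebra fingroup perm.
From mathcomp Require Import all_classical all_reals all_analysis.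
From mathcomp Require Import zify ring lra.

Set Implicit Arguments.
Unset Strict Implicit.
Unset Printing Implicit Defensive.

Import Order.TTheory GRing.Theory Num.Theory.
Import numFieldNormedType.Exports.

Local Open Scope classical_set_scope.
Local Open Scope ring_scope.

(** Let the last car end in space p.  Space p then stays free until the very
    end, so the cars preferring a space below p and those preferring a space
    above p never interact: they form parking functions on the p - 1 spaces to
    the left and on the n - p spaces to the right, shuffled in an arbitrary
    way, and the last car may prefer any of the p spaces 1, ..., p.  If the
    j - 1 cars before it are also required to end at given spaces to the left
    of p, only the choice of the earlier cars that go right remains.  This is
    [last_count_rcons]; iterated, it factors the number of parking functions
    whose last j cars end in increasing order with prescribed gaps.  Summed
    over p, it also determines by induction, through Abel's binomial identity
    [abel_binomial], the total number (n + 1)^(n - 1) of parking functions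
    [last_count_total].  After division each factor converges to a Borel mass,
    so the probability of a fixed vector of gaps converges to the product of
    the Borel masses of its entries [gap_limit].

    Convergence of point masses gives convergence in law as soon as the limit
    masses add up to 1: finitely many gap vectors carry all but epsilon of the
    limit mass, hence for large n all but 2 epsilon of the mass, and a bounded
    function is integrated up to a multiple of epsilon by its values on them
    [expectation_approx], [park_expectation_cvg].  That no mass is lost
    [borel_mass] is again Abel's identity, read as a renewal equation
    g_n = sum_k b_k g_(n-k) between the Borel masses b_k and the numbers
    g_n = e^(-n) n^n / n!: the sum of the g_n diverges, which is impossible if
    the b_k add up to less than 1.

    The last j cars park in increasing order on every gap event, so applying
    the same limit theorem to the indicator function of that event shows that
    its probability tends to 1. *)

(** * Sums over words *)

Section tuple_sums.
Local Open Scope nat_scope.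

Lemma sum_tuple0 (T : finType) (F : seq T -> nat) :
  \sum_(t : 0.-tuple T) F t = F [::].
Proof.
by rewrite (big_pred1 [tuple]) // => t; apply/esym/eqP; exact: tuple0.
Qed.

Lemma sum_tupleS (T : finType) N (F : seq T -> nat) :
  \sum_(t : N.+1.-tuple T) F t = \sum_(x : T) \sum_(t : N.-tuple T) F (x :: t).
Proof.
rewrite pair_big /=.
rewrite (reindex (fun p : T * N.-tuple T => [tuple of p.1 :: p.2])) /=; last first.
  exists (fun t : N.+1.-tuple T => (thead t, [tuple of behead t])) => [[x t] _|t _].
    by congr pair; apply: val_inj.
  by rewrite [RHS]tuple_eta; apply: val_inj.
by apply: eq_bigr => -[x t].
Qed.

Lemma sum_tuple_cat (T : finType) M N (F : seq T -> nat) :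
  \sum_(t : (M + N).-tuple T) F t =
  \sum_(s : M.-tuple T) \sum_(t : N.-tuple T) F (s ++ t).
Proof.
elim: M F => [|M IHM] F.
  by rewrite (sum_tuple0 (fun s => \sum_(t : N.-tuple T) F (s ++ t))).
rewrite addSn sum_tupleS (sum_tupleS _ (fun s => \sum_(t : N.-tuple T) F (s ++ t))).
by apply: eq_bigr => x _; exact: (IHM (fun s => F (x :: s))).
Qed.

Lemma sum_tuple_rcons (T : finType) N (F : seq T -> nat) :
  \sum_(t : N.+1.-tuple T) F t =
  \sum_(x : T) \sum_(t : N.-tuple T) F (rcons t x).
Proof.
elim: N F => [|N IHN] F.
  rewrite sum_tupleS; apply: eq_bigr => x _.
  by rewrite (sum_tuple0 (fun t => F (x :: t))) (sum_tuple0 (fun t => F (rcons t x))).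
rewrite sum_tupleS; under eq_bigr => y _ do rewrite (IHN (fun t => F (y :: t))).
rewrite exchange_big; apply: eq_bigr => x _.
by rewrite (sum_tupleS _ (fun t => F (rcons t x))).
Qed.

Definition below (p : nat) (t : seq nat) := [seq x <- t | x < p].
Definition above (p : nat) (t : seq nat) := [seq x - p.+1 | x <- t & p < x].

(** A word avoiding the letter p is a shuffle of a word over the letters below
    p and a word over those above p; the binomial counts the shuffles.  By
    induction on the length: fixing the first letter replaces [F] or [G] by the
    function of the remaining word, and the two cases add up by Pascal's
    rule. *)
Lemma sum_words_avoiding n p N (F G : seq nat -> nat) : p < n ->
  \sum_(t : N.-tuple 'I_n)
      (p \notin map val t) *
      (F (below p (map val t)) * G (above p (map val t))) =
  \sum_(a < N.+1) 'C(N, a) *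
    ((\sum_(t : a.-tuple 'I_p) F (map val t)) *
     (\sum_(t : (N - a).-tuple 'I_(n - p.+1)) G (map val t))).
Proof.
move=> pn; elim: N F G => [|N IHN] F G.
  rewrite (sum_tuple0 (fun t => (p \notin map val t) *
    (F (below p (map val t)) * G (above p (map val t))))) big_ord1 /=.
  rewrite (sum_tuple0 (fun t => F (map val t))) subn0.
  by rewrite (sum_tuple0 (fun t => G (map val t))) !mul1n.
rewrite (sum_tupleS _ (fun t => (p \notin map val t) *
    (F (below p (map val t)) * G (above p (map val t))))) /=.
pose B a := \sum_(t : a.-tuple 'I_(n - p.+1)) G (map val t).
pose A a := \sum_(t : a.-tuple 'I_p) F (map val t).
pose H x := \sum_(t : N.-tuple 'I_n)
  (p \notin x :: map val t) *
  (F (below p (x :: map val t)) * G (above p (x :: map val t))).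
transitivity (\sum_(x < n) H x); first by [].
have HL x : x < p -> H x = \sum_(a < N.+1) 'C(N, a) *
    ((\sum_(t : a.-tuple 'I_p) F (x :: map val t)) * B (N - a)).
  move=> xp; rewrite /B -(IHN (fun s => F (x :: s)) G); apply: eq_bigr => t _ /=.
  by rewrite /below /above /= xp inE negb_or neq_ltn xp orbT /= ltnNge (ltnW xp).
have HR x : x < n - p.+1 -> H (p.+1 + x) = \sum_(a < N.+1) 'C(N, a) *
    (A a * (\sum_(t : (N - a).-tuple 'I_(n - p.+1)) G (x :: map val t))).
  move=> xn; rewrite /A -(IHN F (fun s => G (x :: s))); apply: eq_bigr => t _ /=.
  rewrite /below /above /= ifF; last by rewrite ltnNge addSn leqW// leq_addr.
  rewrite addSn ltnS leq_addr /= subSS addKn inE negb_or neq_ltn ltnS.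
  by rewrite leq_addr.
have H0 : H p = 0.
  by rewrite /H big1// => t _ /=; rewrite inE eqxx.
have -> : \sum_(x < n) H x = \sum_(x < p) H x + \sum_(x < n - p.+1) H (p.+1 + x).
  rewrite -(big_mkord xpredT H) (big_cat_nat (n := p)) ?(ltnW pn)//=.
  rewrite big_mkord (big_ltn pn) H0 add0n; congr addn.
  rewrite -{1}[p.+1]add0n big_addn.
  by rewrite big_mkord; apply: eq_bigr => x _; rewrite addnC.
rewrite (eq_bigr (fun x : 'I_p => \sum_(a < N.+1) 'C(N, a) *
    ((\sum_(t : a.-tuple 'I_p) F (val x :: map val t)) * B (N - a)))); last first.
  by move=> x _; exact: HL.
rewrite [X in _ + X](eq_bigr (fun x : 'I_(n - p.+1) => \sum_(a < N.+1) 'C(N, a) *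
    (A a *
     (\sum_(t : (N - a).-tuple 'I_(n - p.+1)) G (val x :: map val t)))));
  last first.
  by move=> x _; exact: HR.
rewrite exchange_big [X in _ + X]exchange_big /=.
transitivity (\sum_(a < N.+1) 'C(N, a) * (A a.+1 * B (N - a)) +
              \sum_(a < N.+1) 'C(N, a) * (A a * B (N - a).+1)).
  congr addn; apply: eq_bigr => a _.
    by rewrite -big_distrr -big_distrl /= /A (sum_tupleS _ (fun t => F (map val t))).
  by rewrite -big_distrr -big_distrr /= /B (sum_tupleS _ (fun t => G (map val t))).
(* Pascal's rule, after splitting off the term a = 0 *)
rewrite -/(A _) [RHS]big_ord_recl /= bin0 mul1n subn0 -/(A 0) -/(B N.+1).
under [in RHS]eq_bigr => a _ do
  rewrite /bump /= add1n subSS binS mulnDl -/(A _) -/(B _).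
rewrite big_split /= [in RHS]big_ord_recr /= bin_small// mul0n addn0.
rewrite [X in _ + X = _]big_ord_recl /= bin0 mul1n subn0 addnCA.
rewrite [X in _ + X = _]addnC; congr (_ + (_ + _)%N)%N; apply: eq_bigr => a _.
by rewrite /bump /= add1n subnSK.
Qed.

End tuple_sums.

(** * Counting preferences by where the cars end *)

Section weights.
Local Open Scope nat_scope.

(** A car ends in the free space k exactly when the spaces from its preference
    up to k - 1 are all taken; this is the number of such preferences. *)
Definition pref_count (occ : seq nat) (k : nat) : nat :=
  \sum_(x < k.+1) all [in occ] (iota x (k - x)).

(** The number of preference sequences that make successive cars end at the
    spaces [t], when those in [occ] are taken; see [sum_spaces_eq].  Grouping
    parking functions by where the cars end replaces the parking process by a
    product, in which the two sides of a free space decouple. *)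
Fixpoint weight (occ t : seq nat) : nat :=
  if t is k :: t' then (k \notin occ) * pref_count occ k * weight (k :: occ) t'
  else 1.

Lemma eq_pref_count occ occ' k :
  occ =i occ' -> pref_count occ k = pref_count occ' k.
Proof.
by move=> eo; apply: eq_bigr => x _; congr (nat_of_bool _); exact: eq_all.
Qed.

Lemma mem_below p occ x : (x \in below p occ) = (x < p) && (x \in occ).
Proof. by rewrite mem_filter. Qed.

Lemma mem_above p occ x : (x \in above p occ) = (p.+1 + x \in occ).
Proof.
apply/mapP/idP => [[y] | xo].
  by rewrite mem_filter => /andP[py yo] ->; rewrite subnKC.
by exists (p.+1 + x); rewrite ?mem_filter ?xo ?addKn// andbT addSn ltnS leq_addr.
Qed.

Lemma pref_count_below p occ k : k < p ->
  pref_count (below p occ) k = pref_count occ k.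
Proof.
move=> kp; apply: eq_bigr => -[x /= xk] _; congr (nat_of_bool _).
apply: eq_in_all => y; rewrite mem_iota subnKC// => /andP[_ yk] /=.
by rewrite mem_below (ltn_trans yk kp).
Qed.

(** A preference at or below the free space p cannot lead to a space above
    it. *)
Lemma pref_count_above p occ k : p \notin occ ->
  pref_count occ (p.+1 + k) = pref_count (above p occ) k.
Proof.
move=> po; rewrite /pref_count.
rewrite -(big_mkord xpredT (fun x => nat_of_bool (all [in occ] (iota x (p.+1 + k - x))))).
rewrite (big_cat_nat (n := p.+1)) //=; last by rewrite ltnS ltnW// ltnS leq_addr.
rewrite [X in X + _]big_nat_cond big1 ?add0n => [|x]; last first.
  rewrite andbT ltnS => /andP[_ xp]; apply/eqP; rewrite eqb0.
  apply/allPn; exists p => //; rewrite mem_iota xp subnKC ?addSn ?ltnS ?leq_addr//.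
  by rewrite (leq_trans xp)// leqW// leq_addr.
rewrite -{1}[p.+1]add0n big_addn -addnS addKn big_mkord; apply: eq_bigr => x _.
rewrite addnC subnDl iotaDl all_map; congr (nat_of_bool _); apply: eq_all => y.
by rewrite /= mem_above.
Qed.

(** While p is free, whether a space on one side of p can be reached depends
    only on the taken spaces on that side. *)
Lemma weight_split p occ t : p \notin occ -> p \notin t ->
  weight occ t = weight (below p occ) (below p t) *
                 weight (above p occ) (above p t).
Proof.
elim: t occ => [|k t IHt] occ po; first by rewrite muln1.
rewrite inE negb_or => /andP[pk pt] /=.
rewrite (IHt (k :: occ)) ?inE ?negb_or ?pk//.
rewrite /below /above /=; move: pk; rewrite neq_ltn => /orP[pk|kp].
  rewrite pk ltnNge (ltnW pk) /= -!/(below _ _) -!/(above _ _).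
  rewrite -(subnKC pk) mem_above pref_count_above// addKn.
  by rewrite mulnCA.
rewrite kp ltnNge (ltnW kp) /= -!/(below _ _) -!/(above _ _).
by rewrite mem_below kp pref_count_below// mulnA.
Qed.

Lemma weight_rcons occ t p : weight occ (rcons t p) =
  weight occ t * ((p \notin t) * (p \notin occ) * pref_count (t ++ occ) p).
Proof.
elim: t occ => [|k t IHt] occ; first by rewrite /= !mul1n muln1.
rewrite /= IHt mulnA !inE !negb_or.
rewrite (@eq_pref_count (t ++ k :: occ) (k :: t ++ occ)).
  by rewrite !mulnb andbCA andbA.
by move=> x; rewrite !(inE, mem_cat) orbCA.
Qed.

Lemma weight_uniq occ t : weight occ t != 0 -> uniq t && ~~ has [in occ] t.
Proof.
elim: t occ => //= k t IHt occ; rewrite !muln_eq0 !negb_or.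
move=> /andP[/andP[ko _] /IHt /andP[-> ht]]; rewrite andbT.
rewrite eqb0 negbK in ko; rewrite ko /=.
apply/andP; split.
  by apply: contra ht => kt; apply/hasP; exists k; rewrite //= mem_head.
by apply: contra ht => /hasP[x xt xo]; apply/hasP; exists x; rewrite //= inE xo orbT.
Qed.

(** The number of parking functions on n spaces whose last cars end, in this
    order, at the spaces [u]; see [card_last_spaces].  For [u] empty this is
    the number of all parking functions. *)
Definition last_count (n : nat) (u : seq nat) : nat :=
  \sum_(t : (n - size u).-tuple 'I_n) weight [::] (map val t ++ u).

(** When n - 1 cars occupy everything but p, every preference up to p brings
    the last car to p. *)
Lemma weight_full n p t : p < n -> size t = n.-1 -> all (ltn^~ n) t ->
  weight [::] (rcons t p) = (p \notin t) * weight [::] t * p.+1.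
Proof.
move=> pn st tn; rewrite weight_rcons muln1 mulnCA mulnA cats0.
case: (eqVneq (weight [::] t) 0) => [->|/weight_uniq/andP[ut _]]; first by rewrite !muln0.
case: (boolP (p \in t)) => //= pt; congr (_ * _).
rewrite /pref_count (eq_bigr (fun=> 1)) ?sum1_card ?card_ord// => x _.
(* n distinct numbers below n are all of them *)
have tP : p :: t =i iota 0 n.
  have upt : uniq (p :: t) by rewrite /= pt.
  have sub : {subset p :: t <= iota 0 n}.
    move=> y; rewrite inE mem_iota => /orP[/eqP->//|/(allP tn)]; exact.
  have sz : size (iota 0 n) <= size (p :: t).
    by rewrite /= st size_iota (ltn_predK pn).
  by have [] := uniq_min_size upt sub sz.
apply/eqP; rewrite eqb1; apply/allP => y.
rewrite mem_iota subnKC -1?ltnS// => /andP[_ yp].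
have := tP y; rewrite inE mem_iota /= (ltn_trans yp pn).
by rewrite (ltn_eqF yp).
Qed.

Lemma weight_overfull n t : n < size t -> all (ltn^~ n) t -> weight [::] t = 0.
Proof.
move=> nt tn; apply/eqP; apply: contraTT nt => /weight_uniq/andP[ut _].
rewrite -leqNgt -[leqRHS](size_iota 0 n); apply: uniq_leq_size => // y /(allP tn).
by rewrite mem_iota.
Qed.

Lemma all_val_ltn n (t : seq 'I_n) : all (ltn^~ n) (map val t).
Proof. by apply/allP => _ /mapP[x _ ->]; exact: ltn_ord. Qed.

(** The spaces being numbered from 0, there are p spaces to the left of the
    last car.  The cars listed in [u] all go left, so the binomial chooses the
    other cars that go left; in the sum over shuffles only one length of the
    left word survives, since the other lengths put too many cars on one
    side. *)
Lemma last_count_rcons n p u : p < n -> size u <= p -> all (ltn^~ p) u ->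
  last_count n (rcons u p) =
  'C(n.-1 - size u, p - size u) *
    (p.+1 * last_count p u * last_count (n - p.+1) [::]).
Proof.
move=> pn up ub; rewrite /last_count size_rcons.
set N := n - _.
have NE : N = n.-1 - size u by rewrite /N subnS -subn1 subnAC subn1.
have un t : below p (t ++ u) = below p t ++ u.
  by rewrite /below filter_cat; congr (_ ++ _); apply/all_filterP.
have au t : above p (t ++ u) = above p t.
  rewrite /above filter_cat [X in _ ++ X](_ : _ = [::]) ?cats0//.
  rewrite -(filter_pred0 u); apply: eq_in_filter => x /(allP ub).
  by move=> xp; rewrite ltnNge (ltnW xp).
have pu : p \notin u by apply/negP => /(allP ub) /=; rewrite ltnn.
transitivity (p.+1 * \sum_(t : N.-tuple 'I_n)
    (p \notin map val t) * (weight [::] (below p (map val t) ++ u) *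
                            weight [::] (above p (map val t)))).
  rewrite big_distrr; apply: eq_bigr => t _ /=.
  rewrite -rcons_cat (weight_full pn); last 2 first.
  - rewrite size_cat size_map size_tuple NE subnK//.
    by rewrite (leq_trans up)// -ltnS (ltn_predK pn).
  - rewrite all_cat all_val_ltn /=; apply/allP => x /(allP ub) xp.
    exact: ltn_trans xp pn.
  rewrite mem_cat (negbTE pu) orbF mulnC; congr (_ * _).
  case: (boolP (p \in _)) => //= pt; rewrite !mul1n.
  rewrite (weight_split (p := p)) ?un ?au//.
  by rewrite mem_cat negb_or pt.
rewrite (sum_words_avoiding _ (fun s => weight [::] (s ++ u)) (weight [::]) pn).
have pN : p - size u < N.+1.
  by rewrite ltnS NE leq_sub2r// -ltnS (ltn_predK pn).
rewrite (bigD1 (Ordinal pN)) //= [X in _ + X]big1 => [|a /eqP ap]; last first.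
  apply/eqP; rewrite !muln_eq0; apply/or3P.
  case: (ltngtP a (p - size u)) => apu.
  - apply: Or33; apply/eqP; apply: big1 => t _.
    apply: (weight_overfull _ (all_val_ltn _)).
    by rewrite size_map size_tuple; move: (val a) apu => b; rewrite /N; lia.
  - apply: Or32; apply/eqP; apply: big1 => t _; apply: (@weight_overfull p).
      by rewrite size_cat size_map size_tuple; move: (val a) apu => b; lia.
    by rewrite all_cat all_val_ltn.
  - by case: ap; apply: val_inj.
have nilE M : \sum_(t : (M - 0).-tuple 'I_M) weight [::] (map val t ++ [::]) =
              \sum_(t : M.-tuple 'I_M) weight [::] (map val t).
  by rewrite subn0; apply: eq_bigr => t _; rewrite cats0.
rewrite nilE addn0 -NE mulnCA; congr (_ * _); rewrite !mulnA; congr (_ * _).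
by have -> : N - (p - size u) = n - p.+1 by rewrite /N; lia.
Qed.

End weights.

(** * Abel's identity and the number of parking functions *)

Lemma bin_exchange n k i :
  ('C(n, k) * 'C(n - k, i) = 'C(n, i) * 'C(n - i, k))%N.
Proof.
have [kin|nki] := leqP (k + i) n; last first.
  have nki' : (n - k < i)%N || (n < k)%N by lia.
  have nik' : (n - i < k)%N || (n < i)%N by lia.
  by case/orP: nki' => /bin_small->; case/orP: nik' => /bin_small->; rewrite ?muln0.
have F : (0 < k`! * (i`! * (n - k - i)`!))%N by rewrite !muln_gt0 !fact_gt0.
apply/eqP; rewrite -(eqn_pmul2r F); apply/eqP.
transitivity n`!.
  have kn : (k <= n)%N by lia.
  have ink : (i <= n - k)%N by lia.
  by rewrite -(bin_fact kn) -(bin_fact ink); ring.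
have in_ : (i <= n)%N by lia.
have kni : (k <= n - i)%N by lia.
by rewrite -(bin_fact in_) -(bin_fact kni) [(n - k - i)%N]subnAC; ring.
Qed.

Section abel.
Variable K : comNzRingType.

(** A d-th finite difference kills polynomials of degree less than d.  Writing
    a factor x + k as x plus k and absorbing k into the binomial lowers the
    degree and the order of the difference together. *)
Lemma alternating_binomial_sum (d e : nat) (x : K) : (e < d)%N ->
  \sum_(k < d.+1) (-1) ^+ k * 'C(d, k)%:R * (x + k%:R) ^+ e = 0.
Proof.
elim: e d x => [|e IHe] [//|d] x ed.
  transitivity ((1 - 1 : K) ^+ d.+1); last by rewrite subrr expr0n.
  rewrite exprBn; apply: eq_bigr => k _.
  by rewrite !expr1n !mulr1 mulr_natr.
rewrite (eq_bigr (fun k : 'I_d.+2 => x * ((-1) ^+ k * 'C(d.+1, k)%:R * (x + k%:R) ^+ e) +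
    (-1) ^+ k * ('C(d.+1, k) * k)%:R * (x + k%:R) ^+ e)); last first.
  by move=> k _; rewrite exprS natrM; ring.
rewrite big_split -big_distrr /= IHe ?mulr0 ?add0r; last exact: ltnW.
rewrite big_ord_recl /= muln0 mulr0 mul0r add0r.
rewrite (eq_bigr (fun k : 'I_d.+1 => - d.+1%:R *
    ((-1) ^+ k * 'C(d, k)%:R * (x + 1 + k%:R) ^+ e))); last first.
  move=> [k /= _] _; rewrite /bump /= add1n mulnC -mul_bin_diag natrM exprS.
  have -> : x + k.+1%:R = x + 1 + k%:R by rewrite -[k.+1]add1n natrD addrA.
  by move: (_ ^+ e) => z; ring.
by rewrite -big_distrr /= IHe ?mulr0.
Qed.

(** With z = y + n + 1 the last factor is a power of z - (k + 1).  Expanding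
    it, the coefficient of each z^i with i < n is a finite difference of order
    n - i of a power n - i - 1, hence 0. *)
Lemma abel_binomial (n : nat) (y : K) :
  \sum_(k < n.+1) 'C(n, k)%:R * k.+1%:R ^+ k.-1 * (y + (n - k)%:R) ^+ (n - k)
  = (y + n.+1%:R) ^+ n.
Proof.
set z := y + _.
have expand (k : 'I_n.+1) : (y + (n - k)%:R) ^+ (n - k) =
    \sum_(i < n.+1) (- k.+1%:R) ^+ (n - k - i) * z ^+ i * 'C(n - k, i)%:R.
  have kn : (k <= n)%N by rewrite -ltnS.
  have -> : y + (n - k)%:R = - k.+1%:R + z.
    by rewrite /z natrB// -(natr1 n) -(natr1 k); ring.
  rewrite exprDn (big_ord_widen n.+1 (fun i =>
    (- k.+1%:R) ^+ (n - k - i) * z ^+ i *+ 'C(n - k, i))); last first.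
    by rewrite ltnS leq_subr.
  rewrite big_mkcond; apply: eq_bigr => i _.
  by rewrite ltnS mulr_natr; case: leqP => // nki; rewrite bin_small// mulr0n.
under eq_bigr do rewrite expand big_distrr.
rewrite exchange_big (bigD1 ord_max) //= [X in _ + X]big1 => [|i im].
  rewrite addr0 (bigD1 ord0) //= big1 => [|[k /= kn] k0].
    by rewrite !bin0 !mul1r subn0 subnn binn mulr1 expr0 mul1r addr0.
  rewrite (@bin_small (n - k)) ?mulr0//.
  suff : (k != 0)%N by lia.
  by apply: contraNneq k0 => k0; apply/eqP/val_inj.
have iltn : (i < n)%N.
  rewrite ltn_neqAle -ltnS ltn_ord andbT.
  by apply: contraNneq im => im; apply/eqP/val_inj.
pose d := (n - i)%N.
rewrite (eq_bigr (fun k : 'I_n.+1 => 'C(n, i)%:R * z ^+ i * (-1) ^+ d *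
   ((-1) ^+ k * 'C(d, k)%:R * (1 + k%:R) ^+ d.-1))); last first.
  move=> [k /= kn] _.
  have binE := bin_exchange n k i.
  transitivity (('C(n, k) * 'C(n - k, i))%:R * z ^+ i *
     (k.+1%:R ^+ k.-1 * (- k.+1%:R) ^+ (n - k - i))).
    by rewrite natrM; ring.
  rewrite binE; have [dk|kd] := ltnP d k.
    by rewrite (bin_small dk) muln0 mul0r mul0r mulr0 mul0r mulr0.
  have -> : (-1) ^+ d = (-1) ^+ k * (-1) ^+ (n - k - i) :> K.
    by rewrite -exprD; congr (_ ^+ _); rewrite /d; rewrite /d in kd; lia.
  have -> : k.+1%:R ^+ k.-1 * (- k.+1%:R) ^+ (n - k - i)
     = (-1) ^+ (n - k - i) * (1 + k%:R) ^+ d.-1 :> K.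
    rewrite [(- _) ^+ _]exprNn mulrCA; congr (_ * _).
    rewrite -[k.+1]add1n natrD -exprD.
    case: k kd {kn binE} => [|k] kd; first by rewrite addr0 !expr1n.
    by congr (_ ^+ _); rewrite /d; rewrite /d in kd; lia.
  have : (-1) ^+ k * (-1) ^+ k = 1 :> K by rewrite -expr2 sqrr_sign.
  by rewrite natrM; move: ((-1) ^+ k) => s ss; ring: ss.
rewrite -big_distrr /=.
have := @alternating_binomial_sum d d.-1 1; rewrite ltn_predL subn_gt0 => /(_ iltn) alt.
rewrite [X in _ * X](_ : _ = 0) ?mulr0 // -[RHS]alt.
rewrite [RHS](big_ord_widen n.+1 (fun k =>
  (-1) ^+ k * 'C(d, k)%:R * (1 + k%:R) ^+ d.-1)); last first.
  by rewrite ltnS leq_subr.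
rewrite [RHS]big_mkcond; apply: eq_bigr => k _.
by rewrite ltnS; case: leqP => // dk; rewrite (bin_small dk) mulr0 mul0r.
Qed.

End abel.

Section total_count.
Local Open Scope nat_scope.

(** Splitting according to the space p of the last car gives a recursion for
    these numbers, whose solution is Abel's identity at y = 1. *)
Lemma last_count_total n : last_count n [::] = n.+1 ^ n.-1.
Proof.
elim/ltn_ind: n => -[|n] IHn.
  by rewrite /last_count (sum_tuple0 (fun t => weight [::] (map val t ++ [::]))).
have -> : last_count n.+1 [::] = \sum_(p < n.+1) last_count n.+1 [:: val p].
  rewrite /last_count /= subn0 subn1 /=.
  rewrite (sum_tuple_rcons _ (fun t => weight [::] (map val t ++ [::]))).
  apply: eq_bigr => x _; apply: eq_bigr => t _.
  by rewrite cats0 map_rcons cats1.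
transitivity (\sum_(p < n.+1) 'C(n, p) * (p.+1 ^ p * (n - p).+1 ^ (n - p).-1)).
  apply: eq_bigr => p _; rewrite -[[:: _]]/(rcons [::] (val p)).
  rewrite (last_count_rcons (u := [::]))//= !subn0 subSS.
  rewrite (IHn _ (ltn_ord p)) IHn ?ltnS ?leq_subr//.
  by case: p => -[|p] //= _; rewrite -expnS.
rewrite (reindex_inj rev_ord_inj) /=.
apply/eqP; rewrite -(eqr_nat int) natr_sum natrX; apply/eqP.
rewrite -[n.+2]add1n natrD -abel_binomial; apply: eq_bigr => -[k /= kn] _.
rewrite subSS subKn// bin_sub// !natrM !natrX; rewrite -[(n - k).+1]add1n natrD.
by ring.
Qed.

End total_count.

(** * The Borel masses add up to at least 1 *)

Section borel_mass.
Variable R : realType.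

Lemma borel_pmf_ge0 m : 0 <= borel_pmf R m.
Proof.
by case: m => //= m; rewrite divr_ge0// mulr_ge0 ?expR_ge0// exprn_ge0.
Qed.

(** In terms of a random walk with Borel jumps, the probability of visiting
    n. *)
Let g (n : nat) : R := n%:R ^+ n * expR (- n%:R) / n`!%:R.

Let g_ge0 n : 0 <= g n.
Proof. by rewrite /g divr_ge0// mulr_ge0 ?expR_ge0// exprn_ge0. Qed.

Let fact0 m : m`!%:R != 0 :> R.
Proof. by rewrite pnatr_eq0 -lt0n fact_gt0. Qed.

(** Abel's identity at y = 0. *)
Let g_renewal n : g n.+1 = \sum_(k < n.+1) borel_pmf R k.+1 * g (n - k).
Proof.
rewrite /g exprS factS natrM.
transitivity (expR (- n.+1%:R) / n`!%:R * (0 + n.+1%:R) ^+ n : R).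
  by rewrite add0r; field; rewrite fact0 nat1r pnatr_eq0.
rewrite -(@abel_binomial R n 0) big_distrr; apply: eq_bigr => -[k /= kn] _.
have -> : - n.+1%:R = - k.+1%:R + - (n - k)%:R :> R.
  by rewrite -opprD -natrD addSn subnKC.
rewrite /borel_pmf factS expRD -[in LHS](bin_fact (kn : (k <= n)%N)) !natrM add0r.
have b0 : 'C(n, k)%:R != 0 :> R by rewrite pnatr_eq0 -lt0n bin_gt0.
have -> : k.+1%:R ^+ k = k.+1%:R ^+ k.-1 * (if k == 0%N then 1 else k.+1%:R) :> R.
  by case: (k) => [|l] /=; rewrite ?mulr1// exprSr.
have [->|_] := eqVneq k 0%N; last first.
  by field; rewrite !fact0 b0 nat1r pnatr_eq0.
by field; rewrite !fact0 bin0 oner_eq0.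
Qed.

(** The sequence n g_n is nondecreasing, because (1 + 1/n)^(n+1) >= e; so g
    dominates a multiple of the harmonic sequence. *)
Let g_ge n : expR (- 1) / n.+1%:R <= g n.+1.
Proof.
rewrite ler_pdivrMr ?ltr0n//; elim: n => [|n IHn].
  by rewrite /g expr1 mul1r mulr1 divr1.
apply: le_trans IHn _; have n2 : 0 < n.+2%:R :> R by rewrite ltr0n.
have n1 : 0 < n.+1%:R :> R by rewrite ltr0n.
have grow : n.+1%:R ^+ n.+2 <= n.+2%:R ^+ n.+2 * expR (- 1) :> R.
  have h : n.+1%:R / n.+2%:R <= expR (- n.+2%:R^-1) :> R.
    apply: le_trans (expR_ge1Dx _); rewrite le_eqVlt; apply/orP; left; apply/eqP.
    by rewrite -[n.+2%:R]natr1; field; rewrite nat1r natr1 gt_eqF.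
  have -> : expR (- 1) = expR (- n.+2%:R^-1) ^+ n.+2 :> R.
    by rewrite -expRM_natl mulrN divff// gt_eqF.
  rewrite -exprMn lerXn2r ?nnegrE ?(ltW n1)//.
  by rewrite -ler_pdivrMl// mulrC.
rewrite /g (_ : - n.+2%:R = - n.+1%:R - 1); last by rewrite -natr1 opprD.
rewrite expRD [n.+2`!]factS natrM.
have -> : n.+1%:R ^+ n.+1 * expR (- n.+1%:R) / n.+1`!%:R * n.+1%:R =
    n.+1%:R ^+ n.+2 * (expR (- n.+1%:R) / n.+1`!%:R) :> R.
  by rewrite [_ ^+ n.+2]exprSr; ring.
have -> : n.+2%:R ^+ n.+2 * (expR (- n.+1%:R) * expR (- 1)) /
    (n.+2%:R * n.+1`!%:R) * n.+2%:R =
    n.+2%:R ^+ n.+2 * expR (- 1) * (expR (- n.+1%:R) / n.+1`!%:R) :> R.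
  by field; rewrite fact0 -natrD pnatr_eq0.
by rewrite ler_wpM2r// divr_ge0// expR_ge0.
Qed.

Let partial_renewal N : \sum_(n < N) g n.+1 <=
  (\sum_(k < N) borel_pmf R k.+1) * \sum_(n < N) g n.
Proof.
rewrite big_distrl /=.
under eq_bigr => n _ do
  rewrite g_renewal (big_ord_widen N (fun k => borel_pmf R k.+1 * g (n - k)) (ltn_ord n)).
rewrite (exchange_big_dep xpredT) //=; apply: ler_sum => k _.
rewrite -big_distrr /= ler_wpM2l ?borel_pmf_ge0//.
under eq_bigl do rewrite ltnS.
rewrite -(big_geq_mkord k N xpredT (fun n => g (n - k))) /=.
rewrite -[X in \sum_(X <= i < N) _]add0n big_addn.
under eq_bigr do rewrite addnK.
rewrite -(big_mkord xpredT g) (big_cat_nat (n := (N - k)%N) (p := N)) ?leq_subr//=.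
by rewrite lerDl sumr_ge0.
Qed.

(** If all partial sums of the Borel masses were at most 1 - eps, the renewal
    equation would bound the partial sums of g by 1 / eps, against their
    divergence. *)
Lemma borel_mass (eps : R) : 0 < eps ->
  exists M, 1 - eps <= \sum_(k < M) borel_pmf R k.+1.
Proof.
move=> e0; apply: contrapT => small; apply: (@dvg_harmonic R).
have S_le M : \sum_(k < M) borel_pmf R k.+1 <= 1 - eps.
  by rewrite leNgt; apply/negP => /ltW SM; apply: small; exists M.
apply: nondecreasing_is_cvgn.
  by apply/nondecreasing_series => n _ _; exact: harmonic_ge0.
exists (expR 1 / eps) => _ [N _ <-]; rewrite ler_pdivlMr//.
have G_le : (\sum_(n < N.+1) g n) * eps <= 1.
  have Gle : \sum_(n < N.+1) g n <= 1 + (1 - eps) * \sum_(n < N.+1) g n.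
    apply: (@le_trans _ _ (\sum_(n < N.+2) g n)).
      by rewrite [leRHS]big_ord_recr /= lerDl.
    rewrite big_ord_recl /= {1}/g mul1r oppr0 expR0 divr1 lerD2l.
    apply: le_trans (partial_renewal _) _.
    by rewrite ler_wpM2r// sumr_ge0.
  by move: Gle; lra.
apply: (@le_trans _ _ (expR 1 * ((\sum_(n < N.+1) g n) * eps))); last first.
  by rewrite ler_piMr// expR_ge0.
rewrite mulrA ler_pM2r// /series /= big_mkord big_ord_recl mulrDr big_distrr /=.
rewrite ler_wpDl ?mulr_ge0 ?expR_ge0//; apply: ler_sum => n _.
by rewrite -ler_pdivrMl ?expR_gt0// -expRN.
Qed.

End borel_mass.

(** * Limit of the probability of a vector of gaps *)

Section positions.

(** The spaces, numbered from 0, of the last cars when their gaps are [ms],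
    the gap of the last car being counted from the end of the street. *)
Definition positions (n : nat) (ms : seq nat) : seq nat :=
  [seq (n - sumn (drop i ms))%N | i <- iota 0 (size ms)].

(** The last car cuts the street: the earlier ones see a street that ends just
    before it. *)
Lemma positions_rcons n ms m :
  positions n (rcons ms m) = rcons (positions (n - m) ms) (n - m)%N.
Proof.
rewrite /positions size_rcons -addn1 iotaD map_cat add0n /= cats1.
congr rcons; last by rewrite drop_rcons// drop_size /= addn0.
apply/eq_in_map => i; rewrite mem_iota add0n => /= im.
by rewrite drop_rcons ?(ltnW im)// sumn_rcons addnC subnDA.
Qed.

Lemma size_positions n ms : size (positions n ms) = size ms.
Proof. by rewrite size_map size_iota. Qed.

Lemma positions_lt n ms : all (ltn 0) ms -> (sumn ms <= n)%N ->
  all (ltn^~ n) (positions n ms).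
Proof.
move=> ms0 msn; apply/allP => y /mapP[i].
rewrite mem_iota add0n => /andP[_ im] -> /=.
have drop_gt0 : (0 < sumn (drop i ms))%N.
  rewrite (drop_nth 0%N im) /= addn_gt0.
  by have /= -> := allP ms0 _ (mem_nth 0%N im).
rewrite ltn_subrL drop_gt0 (leq_trans drop_gt0)// (leq_trans _ msn)//.
by rewrite -{2}(cat_take_drop i ms) sumn_cat leq_addl.
Qed.

Lemma positions_sorted n ms : all (ltn 0) ms -> (sumn ms <= n)%N ->
  sorted ltn (positions n ms).
Proof.
rewrite (sorted_pairwise ltn_trans).
elim/last_ind: ms n => [//|ms m IHms] n; rewrite all_rcons sumn_rcons.
case/andP=> _ ms0 msn; rewrite positions_rcons pairwise_rcons IHms ?andbT//.
  by apply: positions_lt => //; lia.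
by lia.
Qed.

Lemma size_le_sumn ms : all (ltn 0) ms -> (size ms <= sumn ms)%N.
Proof. by elim: ms => //= m ms IHms /andP[m0 /IHms]; lia. Qed.

Lemma positions_inj n ms ms' :
  size ms = size ms' -> (sumn ms <= n)%N -> (sumn ms' <= n)%N ->
  positions n ms = positions n ms' -> ms = ms'.
Proof.
elim/last_ind: ms n ms' => [|ms m IHms] n ms'; first by case: ms'.
case/lastP: ms' => [|ms' m']; first by rewrite size_rcons.
rewrite !size_rcons !sumn_rcons !positions_rcons => -[sz] le le'.
case/rcons_inj => pos mm'; have em : m = m' by lia.
by rewrite -em in pos le' *; congr rcons; apply: IHms pos => //; lia.
Qed.

End positions.

Section limits.
Variable R : realType.

Lemma cvg_ratio (a : R) (b : nat) :
  (N%:R + a) / (N + b.+1)%:R @[N --> \oo] --> (1 : R).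
Proof.
have h : (harmonic (N + b)%N : R) @[N --> \oo] --> (0 : R).
  by have := @cvg_harmonic R; rewrite -(cvg_shiftn b).
have -> : (fun N : nat => (N%:R + a) / (N + b.+1)%:R) =
          (fun N => 1 + (a - b.+1%:R) * harmonic (N + b)%N) :> (nat -> R).
  apply/funext => N; rewrite /harmonic /= addnS.
  have nz : (N + b).+1%:R != 0 :> R by rewrite pnatr_eq0.
  apply: (mulIf nz); rewrite mulfVK// mulrDl mulfVK// -addnS natrD; ring.
rewrite [X in _ --> X](_ : 1 = 1 + (a - b.+1%:R) * 0); last by rewrite mulr0 addr0.
by apply: cvgD; [exact: cvg_cst|apply: cvgMl_tmp].
Qed.

(** Both bounds come from 1 + x <= e^x, applied to the ratio
    1 - m/(N+m+1) and to its inverse 1 + m/(N+1). *)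
Lemma cvg_power_expR (m : nat) :
  (N.+1%:R / (N + m.+1)%:R) ^+ N @[N --> \oo] --> expR (- m%:R : R).
Proof.
have lim c : expR (- m%:R * ((N%:R + 0) / (N + c.+1)%:R)) @[N --> \oo] -->
             expR (- m%:R : R).
  rewrite [X in _ --> expR X](_ : _ = - m%:R * 1); last by rewrite mulr1.
  apply: continuous_cvg; first exact: continuous_expR.
  by apply: cvgMl_tmp; exact: cvg_ratio.
apply: squeeze_cvgr (lim 0%N) (lim m); near=> N.
have n1 : 0 < N.+1%:R :> R by rewrite ltr0n.
have nm : 0 < (N + m.+1)%:R :> R by rewrite ltr0n addnS.
have nmE : (N + m.+1)%:R = N.+1%:R + m%:R :> R by rewrite -natrD addnS.
apply/andP; split.
  rewrite addr0 addn1 mulrCA expRM_natl lerXn2r ?nnegrE ?expR_ge0 ?divr_ge0//.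
  rewrite -[leLHS]invrK -expRN -[leRHS]invf_div lef_pV2 ?posrE ?expR_gt0 ?divr_gt0//.
  apply: le_trans (expR_ge1Dx _).
  rewrite le_eqVlt; apply/orP; left; apply/eqP; rewrite nmE.
  by field; rewrite nat1r gt_eqF.
rewrite addr0 mulrCA expRM_natl lerXn2r ?nnegrE ?expR_ge0 ?divr_ge0//.
apply: le_trans (expR_ge1Dx _).
rewrite le_eqVlt; apply/orP; left; apply/eqP; rewrite nmE.
by field; rewrite nat1r -natrD pnatr_eq0.
Unshelve. all: by end_near. Qed.

Lemma cvg_bin_ratio (i r : nat) :
  'C(N + r - i, r)%:R / (N + r.+2)%:R ^+ r @[N --> \oo] --> (r`!%:R^-1 : R).
Proof.
have prod_lim (l : nat) : (l <= r)%N ->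
    \prod_(k < l) ((N + r - i - k)%:R / (N + r.+2)%:R) @[N --> \oo] --> (1 : R).
  elim: l => [|l IHl] lr.
    by under eq_fun do rewrite big_ord0; exact: cvg_cst.
  under eq_fun do rewrite big_ord_recr /=.
  have factor : (N + r - i - l)%:R / (N + r.+2)%:R @[N --> \oo] --> (1 : R).
    apply: cvg_trans (@cvg_ratio (r%:R - i%:R - l%:R) r.+1).
    apply: near_eq_cvg; near=> N; congr (_ / _).
    have iN : (i <= N)%N by near: N; exact: nbhs_infty_ge.
    rewrite !natrB; [rewrite natrD; ring|lia|lia].
  by have h := cvgM (IHl (ltnW lr)) factor; rewrite mulr1 in h; exact: h.
have -> : (fun N => 'C(N + r - i, r)%:R / (N + r.+2)%:R ^+ r : R) =
  (fun N => r`!%:R^-1 * \prod_(k < r) ((N + r - i - k)%:R / (N + r.+2)%:R)).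
  apply/funext => N; rewrite prodf_div prodr_const card_ord mulrA; congr (_ / _).
  by rewrite -natr_prod -ffact_prod -bin_ffact natrM mulrC mulfK.
have h := cvgMl_tmp (a := r`!%:R^-1) (prod_lim r (leqnn r)).
by rewrite mulr1 in h; exact: h.
Unshelve. all: by end_near. Qed.

Definition last_freq (n : nat) (u : seq nat) : R :=
  (last_count n u)%:R / (last_count n [::])%:R.

(** The factor multiplying [last_freq p u] is arranged as a product of three
    expressions whose limits as p grows are known. *)
Lemma last_freq_rcons (p r : nat) (u : seq nat) :
  (size u <= p)%N -> all (ltn^~ p) u ->
  last_freq (p + r.+1) (rcons u p) =
  last_freq p u * ('C(p + r - size u, r)%:R / (p + r.+2)%:R ^+ r *
    (p.+1%:R / (p + r.+2)%:R) ^+ p * r.+1%:R ^+ r.-1).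
Proof.
move=> up ub; rewrite /last_freq.
rewrite last_count_rcons//; last by rewrite addnS ltnS leq_addr.
rewrite addnS subSS addKn !last_count_total /= -addnS.
rewrite -[in LHS](bin_sub (n := (p + r - size u)%N)); last first.
  by rewrite leq_sub2r// leq_addr.
rewrite (_ : p + r - size u - (p - size u) = r)%N; last by lia.
rewrite expr_div_n !natrM !natrX addnS exprD.
have p1 : p.+1%:R ^+ p.-1 != 0 :> R by rewrite expf_neq0// pnatr_eq0.
have pr k : (p + r.+1).+1%:R ^+ k != 0 :> R by rewrite expf_neq0// pnatr_eq0.
have -> : p.+1%:R ^+ p = p.+1%:R * p.+1%:R ^+ p.-1 :> R.
  by case: (p) => [|q] /=; rewrite ?expr0 ?mulr1// exprS.
rewrite !addnS; move: pr; rewrite addnS.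
move: (_ ^+ p.-1) p1 => x x0 pr; field.
by rewrite x0 !expf_neq0 // pnatr_eq0.
Qed.

Lemma gap_limit (ms : seq nat) : all (ltn 0) ms ->
  last_freq n (positions n ms) @[n --> \oo] --> \prod_(m <- ms) borel_pmf R m.
Proof.
elim/last_ind: ms => [_|ms [|r] IHms].
- rewrite big_nil /last_freq.
  under eq_fun => n do
    rewrite divff ?last_count_total ?pnatr_eq0 ?expn_eq0//.
  exact: cvg_cst.
- by rewrite all_rcons.
rewrite all_rcons /= => msgt0.
rewrite -(cvg_shiftn r.+1) -cats1 big_cat big_seq1 cats1.
have -> : borel_pmf R r.+1 =
    r`!%:R^-1 * expR (- r.+1%:R) * r.+1%:R ^+ r.-1 :> R.
  have -> : r.+1%:R ^+ r.-1 = r.+1%:R ^+ r / r.+1%:R :> R.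
    by case: (r) => [|q] /=; rewrite ?divr1// exprSr mulfK// pnatr_eq0.
  rewrite /borel_pmf factS natrM; field.
  by rewrite nat1r !pnatr_eq0 -!lt0n fact_gt0.
pose F p : R := last_freq p (positions p ms) *
  ('C(p + r - size ms, r)%:R / (p + r.+2)%:R ^+ r *
   (p.+1%:R / (p + r.+2)%:R) ^+ p * r.+1%:R ^+ r.-1).
have lim : F p @[p --> \oo] --> \prod_(m <- ms) borel_pmf R m *
    (r`!%:R^-1 * expR (- r.+1%:R) * r.+1%:R ^+ r.-1).
  apply: cvgM (IHms msgt0) _; apply: cvgMr_tmp.
  exact: cvgM (@cvg_bin_ratio (size ms) r) (@cvg_power_expR r.+1).
suff eqF : \forall p \near \oo,
    F p = last_freq (p + r.+1) (positions (p + r.+1) (rcons ms r.+1)).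
  exact: cvg_trans (near_eq_cvg eqF) lim.
near=> p.
rewrite /= positions_rcons addnK last_freq_rcons ?size_positions//.
  by near: p; exact: nbhs_infty_ge.
by apply: positions_lt => //; near: p; exact: nbhs_infty_ge.
Unshelve. all: by end_near. Qed.

End limits.

(** * From weights to parking functions *)

Section parking_counts.
Local Open Scope nat_scope.
Variable n : nat.

Lemma ohead_filter_sorted (P : pred 'I_n) (s : seq 'I_n) (k : 'I_n) :
  sorted ltn (map val s) ->
  (ohead [seq y <- s | P y] == Some k) =
  [&& k \in s, P k & all (fun y : 'I_n => (y < k) ==> ~~ P y) s].
Proof.
elim: s => //= a s IHs as_; have ss := path_sorted as_.
have amin y : y \in s -> a < y.
  by move=> ys; have /allP/(_ _ (map_f _ ys)) := order_path_min ltn_trans as_.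
have [Pa|Pa] := boolP (P a); last first.
  rewrite IHs// implybT inE; case: eqVneq => [->|//] /=.
  by rewrite (negbTE Pa) /= andbF.
rewrite /= implybF inE; apply/eqP/idP => [[<-]|].
  rewrite eqxx Pa ltnn /=; apply/allP => y /amin ay.
  by rewrite ltnNge (ltnW ay).
case/and3P => /predU1P[->//|ks] _ /andP[+ _]; by rewrite amin.
Qed.

Lemma first_freeE (occ : {set 'I_n}) (o : seq nat) (x k : 'I_n) :
  (forall y : 'I_n, (y \in occ) = (val y \in o)) ->
  (first_free occ x == Some k) =
  [&& val k \notin o, x <= k & all [in o] (iota x (k - x))].
Proof.
move=> oE; rewrite /first_free ohead_filter_sorted; last first.
  by rewrite val_enum_ord iota_ltn_sorted.
rewrite mem_enum oE /= -andbA; case: (leqP x k) => xk /=; last by rewrite !andbF.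
congr andb; apply/allP/allP => [h y | h y _]; last first.
  rewrite negb_and negbK oE; apply/implyP => yk; rewrite -implybE.
  by apply/implyP => xy; apply: h; rewrite mem_iota xy subnKC.
rewrite mem_iota subnKC// => /andP[xy yk].
have := h (Ordinal (ltn_trans yk (ltn_ord k))) (mem_enum _ _).
by rewrite /= yk xy /= negbK oE.
Qed.

Lemma sum_first_free (occ : {set 'I_n}) (o : seq nat) (k : 'I_n) :
  (forall y : 'I_n, (y \in occ) = (val y \in o)) ->
  \sum_(x : 'I_n) (first_free occ x == Some k) =
  (val k \notin o) * pref_count o (val k).
Proof.
move=> oE; rewrite /pref_count (big_ord_widen n (fun x =>
  nat_of_bool (all [in o] (iota x (val k - x))))
  (ltn_ord k)).
rewrite [in RHS]big_mkcond big_distrr; apply: eq_bigr => x _ /=.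
by rewrite (first_freeE _ _ oE) ltnS -!mulnb; case: (_ <= _); rewrite ?mul1n ?mul0n.
Qed.

Lemma sum_spaces_eq N (t : seq 'I_n) (occ : {set 'I_n}) (o : seq nat) :
  size t = N -> (forall y : 'I_n, (y \in occ) = (val y \in o)) ->
  \sum_(s : N.-tuple 'I_n) (spaces occ s == map Some t) = weight o (map val t).
Proof.
elim: t N occ o => [|k t IHt] [|N] occ o //= => [_ _|[st] oE].
  by rewrite (sum_tuple0 (fun s => nat_of_bool (spaces occ s == [::]))).
rewrite (sum_tupleS _ (fun s => nat_of_bool (spaces occ s == Some k :: map Some t))) /=.
rewrite -(sum_first_free _ oE) big_distrl; apply: eq_bigr => x _ /=.
rewrite -(IHt N (k |: occ) (val k :: o))//; last first.
  by move=> y; rewrite !inE oE.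
rewrite big_distrr; apply: eq_bigr => s _ /=.
rewrite eqseq_cons; case: eqP => [->|_]; first by rewrite mul1n.
by rewrite mul0n.
Qed.

Definition space_list (pi : parking_function n) : seq 'I_n :=
  [seq space_of pi i | i <- enum 'I_n].

Lemma size_space_list pi : size (space_list pi) = n.
Proof. by rewrite size_map size_enum_ord. Qed.

Lemma spaces_space_list (pi : parking_function n) :
  spaces finset.set0 (val pi) = map Some (space_list pi).
Proof.
have sz : size (spaces finset.set0 (val pi)) = n.
  by rewrite size_spaces size_tuple.
apply: (@eq_from_nth _ None) => [|i]; first by rewrite sz size_map size_space_list.
rewrite sz => i_n; rewrite (space_ofE pi (Ordinal i_n)).
rewrite (nth_map (Ordinal i_n)) ?size_space_list//.
rewrite (nth_map (Ordinal i_n)) ?size_enum_ord//.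
by rewrite (nth_ord_enum (Ordinal i_n) (Ordinal i_n)).
Qed.

Lemma card_spaces (t : seq 'I_n) : size t = n ->
  #|[set pi : parking_function n | space_list pi == t]%SET| =
  weight [::] (map val t).
Proof.
move=> st; rewrite -(@sum_spaces_eq n t finset.set0 [::] st) => [|y]; last by rewrite inE.
rewrite -(card_imset _ val_inj) -sum1_card big_mkcond; apply: eq_bigr => s _ /=.
case: imsetP => [[pi]|h].
  by rewrite inE => /eqP <- ->; rewrite spaces_space_list eqxx.
case: eqP => // hs; case: h.
have sp : is_parking s by rewrite /is_parking hs; apply/mapP => -[].
exists (Sub s sp : parking_function n) => //; rewrite inE; apply/eqP.
have inj : injective (@Some 'I_n) by move=> ? ? [].
by apply: (inj_map inj); rewrite -spaces_space_list.
Qed.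

Lemma bounded_word (u : seq nat) : all (ltn^~ n) u ->
  exists t : (size u).-tuple 'I_n, map val t = u.
Proof.
elim: u => [|a u IHu] /=; first by exists [tuple].
by case/andP => an /IHu [t tE]; exists [tuple of Ordinal an :: t]; rewrite /= tE.
Qed.

Lemma card_last_spaces (u : seq nat) : size u <= n -> all (ltn^~ n) u ->
  #|[set pi : parking_function n |
     drop (n - size u) (map val (space_list pi)) == u]%SET| = last_count n u.
Proof.
move=> un ub; rewrite -sum1_card.
transitivity (\sum_(t : n.-tuple 'I_n)
    (drop (n - size u) (map val t) == u) * weight [::] (map val t)).
  rewrite (partition_big (fun pi => insubd (ord_tuple n) (space_list pi)) xpredT) //=.
  apply: eq_bigr => t _; rewrite -(card_spaces (size_tuple t)) -sum1_card.
  rewrite big_distrr /= big_mkcond [RHS]big_mkcond; apply: eq_bigr => pi _.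
  rewrite !inE -val_eqE val_insubd size_space_list eqxx.
  by case: (space_list pi =P t) => [->|_]; rewrite ?andbF ?andbT ?muln0//; case: eqP.
have [t0 t0E] := bounded_word ub.
rewrite -[in RHS]t0E /last_count.
have E := sum_tuple_cat (n - size u) (size u) (fun t : seq 'I_n =>
   (drop (n - size u) (map val t) == u) * weight [::] (map val t)).
rewrite subnK// in E; rewrite E size_map size_tuple.
apply: eq_bigr => s _; rewrite (bigD1 t0) //= big1 => [|t tt0].
  by rewrite map_cat drop_size_cat ?size_map ?size_tuple// t0E eqxx mul1n addn0.
rewrite map_cat drop_size_cat ?size_map ?size_tuple//.
case: eqP => // tu; case/eqP: tt0; apply/val_inj/(inj_map val_inj).
by rewrite t0E.
Qed.

End parking_counts.

(** * Expectations approximated on finitely many events *)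

Section expectation_approx.
Context d (T : measurableType d) (R : realType) (P : probability T R).
Variables (I : finType) (A : I -> set T).
Hypotheses (mA : forall i, measurable (A i)) (tA : trivIset [set: I] A).

Let U := \big[setU/set0]_(i : I) A i.

Let mU : measurable U.
Proof. by apply: bigsetU_measurable => i _; exact: mA. Qed.

Let tAs : trivIset [set` index_enum I] A.
Proof. by apply: sub_trivIset tA. Qed.

Let PU : fine (P U) = \sum_i fine (P (A i)).
Proof.
have -> : P U = (\sum_i P (A i))%E.
  rewrite -[LHS]mul1e -(integral_cst P mU 1).
  rewrite (integral_bigsetU_EFin P (f := cst 1%R))//.
  - by apply: eq_bigr => i _; rewrite (integral_cst P (mA i) 1) mul1e.
  - exact: index_enum_uniq.
  - by apply/measurable_realfun.measurable_EFinP.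
by rewrite sum_fine// => i _; rewrite fin_num_measure.
Qed.

Lemma sum_prob_le1 : \sum_i fine (P (A i)) <= 1.
Proof.
by rewrite -PU -lee_fin fineK ?fin_num_measure// probability_le1.
Qed.

(** On the union of the [A i] the integral of [h] is the sum; on the complement
    [h] is bounded by [B]. *)
Lemma expectation_approx (h : T -> R) (B : R) (c : I -> R) :
  measurable_fun [set: T] h -> (forall x, `|h x| <= B) ->
  (forall i x, A i x -> h x = c i) ->
  'E_P[h]%E \is a fin_num /\
  `|fine 'E_P[h]%E - \sum_i c i * fine (P (A i))| <=
     B * (1 - \sum_i fine (P (A i))).
Proof.
move=> mh hB hc.
have ih : P.-integrable [set: T] (EFin \o h).
  apply: measurable_bounded_integrable => //.
    by rewrite (le_lt_trans (probability_le1 P _))// ltry.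
  by exists B; split; [exact: num_real|move=> M BM x _; exact: le_trans (hB x) (ltW BM)].
have fE : 'E_P[h]%E \is a fin_num by rewrite unlock integrable_fin_num.
split=> //; rewrite unlock -/(Rintegral _ _ _).
have UT : [set: T] = U `|` ~` U by rewrite setUv.
rewrite UT Rintegral_setU -?UT//; [|exact: measurableC|by apply/disj_setPS; rewrite setICr].
have -> : Rintegral P U h = \sum_i c i * fine (P (A i)).
  rewrite /Rintegral integral_bigsetU_EFin//; last 2 first.
  - exact: index_enum_uniq.
  - by apply/measurable_realfun.measurable_EFinP; exact: measurable_funTS.
  rewrite (eq_bigr (fun i => (c i * fine (P (A i)))%:E)) => [|i _].
    by rewrite sumEFin.
  rewrite (eq_integral (cst (c i)%:E)) => [|x /set_mem /hc->//].
  by rewrite integral_cst// EFinM fineK// fin_num_measure.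
rewrite addrC addKr.
have iC : P.-integrable (~` U) (EFin \o h).
  by apply: integrableS ih => //; exact: measurableC.
apply: le_trans (le_normr_Rintegral _ iC) _; first exact: measurableC.
rewrite -PU.
have -> : 1 - fine (P U) = fine (P (~` U)).
  by rewrite probability_setC// fineB ?fin_num_measure.
have mC : measurable (~` U) by exact: measurableC.
rewrite -lee_fin EFinM [X in (_ <= _ * X)%E]fineK ?fin_num_measure//.
rewrite -(integral_cst P mC B%:E) /Rintegral fineK.
  apply: ge0_le_integral => //.
  - apply/measurable_realfun.measurable_EFinP.
    by apply: measurableT_comp => //; exact: measurable_funTS.
  - by move=> x _; rewrite lee_fin; exact: le_trans (hB x).
by apply: integrable_fin_num => //; exact: integrable_norm.
Qed.

End expectation_approx.

(** * Limits of expectations under the parking measure *)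

Section park_probability.
Variables (R : realType) (n : nat).

Lemma park_probE (A : set 'S_n) : park_prob R n A =
  (#|[set pi : parking_function n | `[< A (outcome pi) >]]%SET|%:R /
   #|{: parking_function n}|%:R)%:E.
Proof.
rewrite /park_prob esum_mkcond esum_fset; [|exact: finite_finset|]; last first.
  by move=> s _; case: ifP => // _; rewrite lee_fin park_pmf_ge0.
rewrite (fsbigE (enum 'S_n)) ?enum_uniq//; last first.
  by move=> s _; rewrite mem_enum.
under eq_bigl do rewrite in_setT.
rewrite big_enum/= -big_mkcond sumEFin -mulr_suml -natr_sum; congr (_%:R / _)%:E.
rewrite -[RHS]sum1_card (partition_big (@outcome n) (fun s => `[< A s >]))/=; last first.
  by move=> pi; rewrite inE.
apply: eq_big => [s|s sA]; first by apply/idP/asboolP; rewrite inE.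
rewrite -sum1_card; apply: eq_bigl => p; rewrite !inE.
case: eqP => [->|_]; last by rewrite andbF.
by rewrite andbT; apply/esym/asboolP; move: sA; rewrite inE.
Qed.

Lemma position_outcome (pi : parking_function n) (i : 'I_n) :
  position (outcome pi) i.+1 = (space_of pi i).+1.
Proof.
rewrite /position; case: insubP => [k _ ki|]; last by rewrite ltn_ord.
by rewrite /outcome invgK permE (val_inj ki).
Qed.

Lemma last_positions (pi : parking_function n) j : (j <= n)%N ->
  [seq position (outcome pi) k | k <- iota (n.+1 - j) j] =
  map S (drop (n - j) (map val (space_list pi))).
Proof.
move=> jn; rewrite subSn// -map_drop /space_list -[in RHS]map_drop -!map_comp.
have -> : iota (n - j).+1 j = [seq (val i).+1 | i <- drop (n - j) (enum 'I_n)].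
  rewrite (map_comp S val) map_drop val_enum_ord drop_iota subKn//.
  by rewrite -[(n - j).+1]addn1 addnC iotaDl.
by rewrite -map_comp; apply: eq_map => i /=; exact: position_outcome.
Qed.

Lemma prob_last_positions (u : seq nat) :
  (size u <= n)%N -> all (ltn^~ n) u ->
  park_prob R n [set sigma | [seq position sigma k |
     k <- iota (n.+1 - size u) (size u)] = map S u] = (last_freq R n u)%:E.
Proof.
move=> un ub; rewrite park_probE /last_freq -!card_last_spaces//.
congr ((_%:R / _%:R)%:E); apply: eq_card => pi; rewrite !inE; last first.
  by rewrite /= subn0 drop_oversize// size_map size_space_list.
rewrite /= last_positions//; apply/asboolP/eqP => [|->//].
by apply: inj_map => ? ? [].
Qed.

End park_probability.

Definition gap_event (n : nat) (ms : seq nat) : set 'S_n :=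
  [set sigma | [seq position sigma k | k <- iota (n.+1 - size ms) (size ms)] =
     map S (positions n ms)].

Arguments gap_event : clear implicits.

Section limit_theorem.
Variables (R : realType) (j : nat).

(** Vectors of j gaps, each between 1 and M, are indexed by finite functions
    so that sums of products over them factor; gaps start at 1, hence the
    successor. *)
Definition gaps M (f : {ffun 'I_j -> 'I_M}) : seq nat :=
  [seq (val (f i)).+1 | i <- enum 'I_j].

Lemma size_gaps M (f : {ffun 'I_j -> 'I_M}) : size (gaps f) = j.
Proof. by rewrite size_map size_enum_ord. Qed.

Lemma gaps_gt0 M (f : {ffun 'I_j -> 'I_M}) : all (ltn 0) (gaps f).
Proof. by apply/allP => _ /mapP[i _ ->]. Qed.

Lemma gaps_inj M : injective (@gaps M).
Proof.
move=> f g /eq_in_map fg; apply/ffunP => i; apply/val_inj/succn_inj.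
exact: fg (mem_enum _ _).
Qed.

Lemma prod_gaps M (f : {ffun 'I_j -> 'I_M}) (F : nat -> R) :
  \prod_(m <- gaps f) F m = \prod_(i < j) F (f i).+1.
Proof. by rewrite big_map big_enum. Qed.

Lemma expr_ge_bernoulli (x a : R) : 0 <= x -> 0 <= a -> 1 - a <= x ->
  1 - a *+ j <= x ^+ j.
Proof.
move=> x0 a0 ax; elim: j => [|k IHk]; first by rewrite mulr0n subr0.
rewrite exprS mulrSr.
have [x1|x1] := leP 1 x.
  apply: (@le_trans _ _ 1); first by rewrite gerBl addr_ge0// mulrn_wge0.
  by rewrite -exprS exprn_ege1.
have xk : 0 <= x ^+ k by rewrite exprn_ge0.
have : 1 - x ^+ k <= a *+ k by lra.
have xk1 : x ^+ k <= 1 by rewrite exprn_ile1// ltW.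
nra.
Qed.

(** The sum factors as the j-th power of a partial sum of Borel masses. *)
Lemma borel_vector_mass (eps : R) : 0 < eps ->
  exists M, 1 - eps <= \sum_(f : {ffun 'I_j -> 'I_M})
                          \prod_(m <- gaps f) borel_pmf R m.
Proof.
move=> e0; have [M SM] := @borel_mass R (eps / j.+1%:R) (divr_gt0 e0 (ltr0Sn _ _)).
exists M; under eq_bigr do rewrite prod_gaps.
rewrite -(bigA_distr_bigA (fun (i : 'I_j) (k : 'I_M) => borel_pmf R k.+1)) /=.
rewrite prodr_const card_ord.
apply: le_trans (expr_ge_bernoulli _ _ SM); last 2 first.
- by apply: sumr_ge0 => k _; exact: borel_pmf_ge0.
- by rewrite divr_ge0// ltW.
rewrite lerD2l lerN2 -[_ *+ j]mulr_natr mulrAC ler_pdivrMr ?ltr0n//.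
by rewrite ler_pM2l// ler_nat.
Qed.

(** The gap events of finitely many vectors carry almost all of the mass, for
    large n and in the limit, so both expectations are close to the same finite
    sum.  L plays the role of the expectation of [c] for independent Borel
    gaps; the last hypothesis expresses this without reference to random
    variables having that distribution, so that [c] constant and L = 1 are
    allowed as well. *)
Lemma park_expectation_cvg (h : forall n, 'S_n -> R) (B L : R) (c : seq nat -> R) :
  (forall n sigma, `|h n sigma| <= B) ->
  (forall n ms, size ms = j -> all (ltn 0) ms -> (sumn ms <= n)%N ->
     forall sigma, gap_event n ms sigma -> h n sigma = c ms) ->
  (forall M, let g (f : {ffun 'I_j -> 'I_M}) :=
       \prod_(m <- gaps f) borel_pmf R m in
     `|L - \sum_f c (gaps f) * g f| <= B * `|1 - \sum_f g f|) ->
  'E_(park_prob R n)[h n]%E @[n --> \oo] --> L%:E.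
Proof.
move=> hB hc hL.
have B0 : 0 <= B by exact: le_trans (hB 0%N 1%g).
pose q M n (f : {ffun 'I_j -> 'I_M}) := last_freq R n (positions n (gaps f)).
have approx M : \forall n \near \oo,
    [/\ 'E_(park_prob R n)[h n]%E \is a fin_num, \sum_f q M n f <= 1 &
     `|fine 'E_(park_prob R n)[h n]%E - \sum_f c (gaps f) * q M n f| <=
      B * (1 - \sum_f q M n f)].
  near=> n.
  have n0 : (0 < n)%N by near: n; exact: nbhs_infty_gt.
  have jn : (j <= n)%N by near: n; exact: nbhs_infty_ge.
  have sn (f : {ffun 'I_j -> 'I_M}) : (sumn (gaps f) <= n)%N.
    (* any bound common to the finitely many gap vectors *)
    apply: (@leq_trans (\sum_(f : {ffun 'I_j -> 'I_M}) sumn (gaps f))%N).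
      by rewrite (bigD1 f)//= leq_addr.
    by near: n; exact: nbhs_infty_ge.
  pose A (f : {ffun 'I_j -> 'I_M}) := gap_event n (gaps f).
  have mA f : measurable (A f) by [].
  have tA : trivIset [set: {ffun 'I_j -> 'I_M}] A.
    move=> f g _ _ [sigma [Af Ag]]; apply: gaps_inj.
    apply: (@positions_inj n); rewrite ?size_gaps ?sn//.
    have Sinj : injective S by move=> ? ? [].
    by apply: (inj_map Sinj); rewrite -Af -Ag /A !size_gaps.
  have PA f : fine (park_prob R n (A f)) = q M n f.
    rewrite /A /gap_event -(size_positions n (gaps f)) prob_last_positions//.
      by rewrite size_positions size_gaps.
    by apply: positions_lt; [exact: gaps_gt0|exact: sn].
  have [fE E] := expectation_approx (park_prob R n) mA tA (h := h n) (B := B)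
     (c := fun f => c (gaps f)) (fun _ _ _ => I) (hB n)
     (fun f s => hc n (gaps f) (size_gaps f) (gaps_gt0 f) (sn f) s).
  have le1 := sum_prob_le1 (park_prob R n) mA tA.
  split=> //.
    by under eq_bigr do rewrite -PA.
  under eq_bigr do rewrite -PA; under [in leRHS]eq_bigr do rewrite -PA.
  exact: E.
apply/fine_cvgP; split.
  by apply: filterS (approx 0%N) => n [].
apply/cvgrPdist_lt => e e0.
(* B + 1 instead of B, as B may vanish *)
have B1 : 0 < B + 1 by rewrite ltr_wpDl.
have e2 : 0 < e / (B + 1) / 3 by rewrite !divr_gt0.
have [M GM] := borel_vector_mass e2.
pose g (f : {ffun 'I_j -> 'I_M}) := \prod_(m <- gaps f) borel_pmf R m.
have qg f : q M n f @[n --> \oo] --> g f by apply: gap_limit; exact: gaps_gt0.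
have sum_q (a : {ffun 'I_j -> 'I_M} -> R) :
    \sum_f a f * q M n f @[n --> \oo] --> \sum_f a f * g f.
  apply: cvg_big => [|f _]; first exact: add_continuous.
  by apply: cvgMl_tmp; exact: qg.
have sum_q1 : \sum_f q M n f @[n --> \oo] --> \sum_f g f.
  by apply: cvg_big => [|f _]; [exact: add_continuous|exact: qg].
have g1 : \sum_f g f <= 1.
  by apply: cvgr_to_le sum_q1 _; apply: filterS (approx M) => n [].
pose eta := e / (B + 1) / 3; pose G := \sum_f g f.
have etaE : B * eta * 3 = e - e / (B + 1) by rewrite /eta; field; rewrite gt_eqF.
have eB0 : 0 < e / (B + 1) by rewrite divr_gt0.
have Geta : B * (1 - G) <= B * eta by rewrite ler_wpM2l// lerBlDr -lerBlDl.
have dL : `|L - \sum_f c (gaps f) * g f| <= B * (1 - G).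
  by apply: le_trans (hL M) _; rewrite -/g ger0_norm// subr_ge0.
have near1 : \forall n \near \oo,
    `|\sum_f c (gaps f) * g f - \sum_f c (gaps f) * q M n f| < e / (B + 1) / 2.
  by apply: cvgr_dist_lt => //; rewrite divr_gt0.
have near2 : \forall n \near \oo,
    B * (1 - \sum_f q M n f) < B * (1 - G) + e / (B + 1) / 2.
  apply: (@cvgr_lt _ _ _ _ _ (B * (1 - G))); last by rewrite ltrDl divr_gt0.
  by apply: cvgMl_tmp; apply: cvgB => //; exact: cvg_cst.
near=> n.
have [_ _ d1] : [/\ 'E_(park_prob R n)[h n]%E \is a fin_num, \sum_f q M n f <= 1 &
     `|fine 'E_(park_prob R n)[h n]%E - \sum_f c (gaps f) * q M n f| <=
      B * (1 - \sum_f q M n f)] by near: n; exact: approx.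
have d2 : `|\sum_f c (gaps f) * g f - \sum_f c (gaps f) * q M n f| < e / (B + 1) / 2.
  by near: n.
have d3 : B * (1 - \sum_f q M n f) < B * (1 - G) + e / (B + 1) / 2 by near: n.
rewrite /=; move: d1 d2 dL; rewrite !ler_norml !ltr_norml => /andP[? ?] /andP[? ?] /andP[? ?].
have Be : 0 <= B * eta by rewrite mulr_ge0 // ltW.
apply/andP; split; lra.
Unshelve. all: by end_near. Qed.

End limit_theorem.

(** * The two limits *)

Lemma sumn_drop_enum j (k : 'I_j -> nat) (i : nat) :
  sumn (drop i [seq k r | r <- enum 'I_j]) = (\sum_(r < j | i <= r) k r)%N.
Proof.
set s := map _ _; have sz : size s = j by rewrite size_map size_enum_ord.
transitivity (\sum_(i <= r < j) nth 0%N s r)%N.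
  rewrite sumnE (big_nth 0%N) size_drop sz -{3}[i]add0n big_addn.
  by apply: eq_bigr => r _; rewrite nth_drop addnC.
rewrite big_geq_mkord; apply: eq_bigr => r _.
by rewrite (nth_map r) ?size_enum_ord// nth_ord_enum.
Qed.

Lemma gap_event_space (n : nat) (ms : seq nat) (sigma : 'S_n) (i : nat) :
  (i < size ms)%N -> (size ms <= n)%N -> gap_event n ms sigma ->
  position sigma (n - size ms + i.+1) = (n - sumn (drop i ms)).+1.
Proof.
move=> im mn /(congr1 (nth 0%N ^~ i)); rewrite (nth_map 0%N) ?size_iota// nth_iota//.
rewrite (nth_map 0%N) ?size_positions// (nth_map 0%N) ?size_iota// nth_iota// add0n.
by rewrite subSn// addSnnS.
Qed.

Section borel_side.
Context d (T : measurableType d) (R : realType) (P : probability T R) (j : nat).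
Variable X : 'I_j -> {RV P >-> nat}.

Let Z (w : T) : {ffun 'I_j -> nat} := [ffun r => X r w].

Let Z_pre (k : {ffun 'I_j -> nat}) :
  Z @^-1` [set k] = \bigcap_(r in [set` [set: 'I_j]%SET]) X r @^-1` [set k r].
Proof.
apply/seteqP; split => [w <- r _|w h]; first by rewrite /= ffunE.
by apply/ffunP => r; rewrite ffunE; apply: h; rewrite /= inE.
Qed.

Let mZ (k : {ffun 'I_j -> nat}) : measurable (Z @^-1` [set k]).
Proof.
rewrite Z_pre; apply: fin_bigcap_measurable => // r _.
exact: measurable_funPTI.
Qed.

(** The vector of the [X r] takes countably many values, each on a measurable
    event, so every function of it is measurable. *)
Lemma measurable_RV_vector (h : {ffun 'I_j -> nat} -> R) :
  measurable_fun [set: T] (fun w => h [ffun r => X r w]).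
Proof.
move=> _ B _; rewrite setTI.
rewrite (_ : _ @^-1` B = \bigcup_k (if `[< B (h k) >] then Z @^-1` [set k] else set0)).
  apply: countable_bigcupT_measurable => [|k]; first exact: countableP.
  by case: ifP => _; [exact: mZ|exact: measurable0].
apply/seteqP; split => [w Bw|w [k _]].
  by exists (Z w) => //; rewrite ifT//; apply/asboolP.
by case: ifPn => // /asboolP Bk zk; rewrite /preimage /= -/(Z w) zk.
Qed.

Hypotheses (indep : mutually_independent X)
  (borelX : forall r, has_borel_distribution (X r)).

Lemma prob_RV_vector (k : {ffun 'I_j -> nat}) :
  measurable [set w | [ffun r => X r w] = k] /\
  fine (P [set w | [ffun r => X r w] = k]) = \prod_(r < j) borel_pmf R (k r).
Proof.
split; first exact: mZ.
rewrite -[[set w | _]]/(Z @^-1` [set k]) Z_pre.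
rewrite (indep [set: 'I_j]%SET (A := fun r => [set k r]))//.
rewrite (eq_bigr (fun r => (borel_pmf R (k r))%:E)) => [|r _]; last exact: borelX.
by rewrite prodEFin /=; apply: eq_bigl => r; rewrite inE.
Qed.

End borel_side.

Theorem corollary9 (R : realType) (j : nat) (j_gt0 : (0 < j)%N) :
  (forall (d : measure_display) (T : measurableType d) (P : probability T R)
      (X : 'I_j -> {RV P >-> nat}),
    mutually_independent X -> (forall r, has_borel_distribution (X r)) ->
    cvg_in_distribution (fun n => park_prob R n)
      (fun n (sigma : 'S_n) =>
        \row_(i < j) (n.+1%:R - (position sigma (n - j + i.+1))%:R))
      P (fun w => \row_(i < j) \sum_(r < j | (i <= r)%N) (X r w)%:R))
  /\
  (fun n => park_prob R n
    [set sigma | sorted ltn [seq position sigma k | k <- iota (n.+1 - j) j]])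
    @ \oo --> 1%E.
Proof.
split.
  move=> d T P X indep borelX f _ [B0 [_ fB0]].
  pose B := B0 + 1; have fB x : `|f x| <= B by apply: fB0 => //; rewrite ltrDl.
  (* both vectors have as coordinates the sums of the tails of their gaps *)
  pose c (ms : seq nat) := f (\row_(i < j) (sumn (drop i ms))%:R).
  pose h (k : {ffun 'I_j -> nat}) : R := 
    f (\row_(i < j) (\sum_(r < j | (i <= r)%N) (k r)%:R)).
  have -> : f \o (fun w => \row_(i < j) \sum_(r < j | (i <= r)%N) (X r w)%:R) =
      (fun w => h [ffun r => X r w]).
    apply/funext => w; rewrite /h /=; congr f; apply/rowP => i; rewrite !mxE.
    by apply: eq_bigr => r _; rewrite ffunE.
  have mh := measurable_RV_vector X h.
  pose S1 M (g : {ffun 'I_j -> 'I_M}) : {ffun 'I_j -> nat} := [ffun r => (val (g r)).+1].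
  pose A M (g : {ffun 'I_j -> 'I_M}) := [set w : T | [ffun r => X r w] = S1 M g].
  have mA M g : measurable (A M g) by have [] := prob_RV_vector indep borelX (S1 M g).
  have tA M : trivIset setT (A M).
    move=> g g' _ _ [w [Ag Ag']]; apply/ffunP => r; apply/val_inj.
    have /ffunP/(_ r) : S1 M g = S1 M g' := etrans (esym Ag) Ag'.
    by rewrite !ffunE => -[].
  have PA M (g : {ffun 'I_j -> 'I_M}) :
      fine (P (A M g)) = \prod_(m <- gaps g) borel_pmf R m.
    have [_ ->] := prob_RV_vector indep borelX (S1 M g).
    by rewrite prod_gaps; apply: eq_bigr => r _; rewrite ffunE.
  have hc M g w : A M g w -> h [ffun r => X r w] = c (gaps g).
    move=> Aw; transitivity (h (S1 M g)); first by congr h; exact: Aw.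
    rewrite /h /c; congr f; apply/rowP => i; rewrite !mxE.
    rewrite /gaps sumn_drop_enum natr_sum; apply: eq_bigr => r _.
    by rewrite ffunE.
  have approx M := expectation_approx P (mA M) (tA M) mh (fun w => fB _) (hc M).
  (* any M serves to see that the expectation is finite *)
  have [fE _] := approx 0%N; rewrite -(fineK fE).
  apply: (@park_expectation_cvg R j _ B _ c) => [n sigma|n ms mj ms0 msn sigma|M].
  - exact: fB.
  - move=> ev /=; rewrite /c; congr f; apply/rowP => i; rewrite !mxE.
    have smn := leq_trans (size_le_sumn ms0) msn.
    have im : (i < size ms)%N by rewrite mj.
    have := gap_event_space im smn ev; rewrite mj => ->.
    have sn : (sumn (drop i ms) <= n)%N.
      by rewrite (leq_trans _ msn)// -{2}(cat_take_drop i ms) sumn_cat leq_addl.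
    by rewrite -natr1 -[in X in _ - X]natr1 natrB//; ring.
  - cbv zeta; have [_] := approx M.
    under eq_bigr do rewrite PA; under [in leRHS]eq_bigr do rewrite PA.
    move/le_trans; apply; rewrite ler_wpM2l ?ler_norm//.
    exact: le_trans (fB 0).
pose E n : set 'S_n :=
  [set sigma | sorted ltn [seq position sigma k | k <- iota (n.+1 - j) j]].
have -> : (fun n => park_prob R n (E n)) = (fun n => 'E_(park_prob R n)[\1_(E n)]%E).
  by apply/funext => n; rewrite expectation_indic.
apply: (@park_expectation_cvg R j _ 1 _ (fun=> 1)) => [n sigma|n ms mj ms0 msn sigma ev|M].
- by rewrite indicE; case: (_ \in _); rewrite ?normr1 ?normr0 ?ler01.
- rewrite indicE mem_set//= /E /= -mj ev.
  rewrite sorted_map; exact: positions_sorted.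
- by cbv zeta; under eq_bigr do rewrite mul1r; rewrite mul1r.
Qed.
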